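(* Let $K\in\mathcal L(\mathcal H)$ have closed range, let $K^\dagger$ be the pseudo-inverse of $K$, and let $\{(W_i,w_i)\}_{i\in I}$ satisfy $K^\dagger K(W_i)\subset W_i$ for all $i\in I$. If $\{(W_i,w_i)\}_{i\in I}$ is a fusion frame for $\mathcal H$, then $\{(KW_i,w_i)\}_{i\in I}$ is a $K$-fusion frame for $\mathcal H$.
   Context: $\mathcal H$ is a separable Hilbert space, $\mathcal L(\mathcal H)$ is the space of bounded linear operators on $\mathcal H$, and $I$ is a countable index set. For a closed subspace $W$, $\pi_W$ denotes the orthogonal projection onto $W$; $R(\cdot)$ and $N(\cdot)$ denote range and kernel. Let $\{W_i\}_{i\in I}$ be a sequence of closed subspaces of $\mathcal H$ and $\{w_i\}_{i\in I}$ a family of weights ($w_i>0$ for all $i$). $\{(W_i,w_i)\}_{i\in I}$ is a fusion frame for $\mathcal H$ if there exist $0<A\le B<\infty$ with $A\|f\|^2\le\sum_{i\in I}w_i^2\|\pi_{W_i}(f)\|^2\le B\|f\|^2$ for all $f\in\mathcal H$; it is a $K$-fusion frame for $\mathcal H$ if there exist $0<A\le B<\infty$ with $A\|K^*f\|^2\le\sum_{i\in I}w_i^2\|\pi_{W_i}(f)\|^2\le B\|f\|^2$ for all $f\in\mathcal H$ (in particular the subspaces are required to be closed). For $K\in\mathcal L(\mathcal H)$ with closed range, the pseudo-inverse $K^\dagger\in\mathcal L(\mathcal H)$ is the unique bounded operator with $N(K^\dagger)=R(K)^\perp$, $R(K^\dagger)=N(K)^\perp$ and $KK^\dagger y=y$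 for all $y\in R(K)$. *)

(* Defs.v *)
From HB Require Import structures.
From mathcomp Require Import all_boot all_order all_algebra.
From mathcomp Require Import complex.
From mathcomp Require Import all_classical all_reals all_analysis.

Set Implicit Arguments.
Unset Strict Implicit.
Unset Printing Implicit Defensive.

Import Order.TTheory GRing.Theory Num.Theory.
Import numFieldNormedType.Exports.

Local Open Scope classical_set_scope.
Local Open Scope ring_scope.

Inductive scalar_kind := RealScalars | ComplexScalars.

Definition scalar_field (R : realType) (k : scalar_kind) : numFieldType :=
  match k with
  | RealScalars => R
  | ComplexScalars => R[i]
  end.

Definition scalar_conj (R : realType) (k : scalar_kind) :
    involutive_rmorphism (scalar_field R k) :=
  match k with
  | RealScalars => @idfun R
  | ComplexScalars => @Num.conj R[i]
  end.

Definition scalar_Re (R : realType) (k : scalar_kind) : scalar_field R k -> R :=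
  match k with
  | RealScalars => fun x => x
  | ComplexScalars => @complex.Re R
  end.

(* The inner product is linear in its first argument and conjugate-linear in
   its second one; [inner_norm] says that it induces the norm of the complete
   normed module. *)
HB.mixin Record isHilbert (R : realType) (k : scalar_kind) H
    of CompleteNormedModule (scalar_field R k) H := {
  inner : {dot H for @scalar_conj R k} ;
  inner_norm : forall x : H, inner x x = `|x| ^+ 2 }.

#[short(type="hilbertType")]
HB.structure Definition Hilbert (R : realType) (k : scalar_kind) :=
  { H of CompleteNormedModule (scalar_field R k) H & isHilbert R k H }.

Section Operators.
Variables (R : realType) (k : scalar_kind) (H : hilbertType R k).
Implicit Types (V : set H) (T S : {linear H -> H}).

(* The library's norm takes its (nonnegative real) values in the scalar
   field. *)
Definition hnorm (x : H) : R := scalar_Re `|x|.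

Definition separable := exists D : set H, countable D /\ dense D.

Definition closed_subspace V := GRing.submod_closed [in V] /\ closed V.

Definition bounded_operator T := exists M : R, forall x, hnorm (T x) <= M * hnorm x.

Definition null_space T : set H := T @^-1` [set 0].

Definition ortho_compl V : set H := [set x | forall y, V y -> inner x y = 0].

(* [orth_proj V f] is the point [g] of [V] such that [f - g] is orthogonal to [V];
   it exists and is unique when [V] is a closed subspace, and the default value
   0 is then not used. *)
Definition orth_proj V (f : H) : H :=
  xget 0 [set g | V g /\ ortho_compl V (f - g)].

(* [adjoint T y] is the vector representing the functional [x |-> <T x, y>]; it
   exists and is unique when [T] is bounded, and the default value 0 is then
   not used. *)
Definition adjoint T (y : H) : H :=
  xget 0 [set z | forall x, inner (T x) y = inner x z].

Definition is_pseudo_inverse T S :=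
  [/\ bounded_operator S,
      null_space S = ortho_compl (range T),
      range S = ortho_compl (null_space T)
    & forall y, range T y -> T (S y) = y].

Section Frames.
Variables (I : countType) (W : I -> set H) (w : I -> R).

Definition weighted_closed_subspaces :=
  forall i, closed_subspace (W i) /\ 0 < w i.

Definition frame_sum (f : H) : \bar R :=
  \esum_(i in [set: I]) (w i ^+ 2 * hnorm (orth_proj (W i) f) ^+ 2)%:E.

Definition fusion_frame :=
  weighted_closed_subspaces /\
  exists A B : R, [/\ 0 < A, A <= B &
    forall f : H, ((A * hnorm f ^+ 2)%:E <= frame_sum f)%E /\
                  (frame_sum f <= (B * hnorm f ^+ 2)%:E)%E].

Definition K_fusion_frame (K : {linear H -> H}) :=
  weighted_closed_subspaces /\
  exists A B : R, [/\ 0 < A, A <= B &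
    forall f : H, ((A * hnorm (adjoint K f) ^+ 2)%:E <= frame_sum f)%E /\
                  (frame_sum f <= (B * hnorm f ^+ 2)%:E)%E].

End Frames.

End Operators.

Arguments separable {R k} H.

(* Main.v *)
Require Import Defs.
From mathcomp Require Import all_boot all_order all_algebra.
From mathcomp Require Import complex.
From mathcomp Require Import all_classical all_reals all_analysis.
From mathcomp Require Import ring lra.

Set Implicit Arguments.
Unset Strict Implicit.
Unset Printing Implicit Defensive.

Import Order.TTheory GRing.Theory Num.Theory.
Import numFieldNormedType.Exports.

Local Open Scope classical_set_scope.
Local Open Scope ring_scope.

(** The estimates come from three identities of the form [<x, x> = <y, z>] with
    [|y| <= M |x|], which by Cauchy-Schwarz give [|x| <= M |z|]
    ([hnorm_le_of_inner]).  Write [P_V] for the orthogonal projection onto [V]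
    and [K'] for the pseudo-inverse.

    The image [K W_i] is [range K] intersected with the preimage of [W_i] under
    [K'], because [W_i] is stable under [K' K] and [K K'] is the identity on
    [range K]; it is therefore a closed subspace.

    - For [g = P_(K W_i) f], the vector [K' g] lies in [W_i] and [K K' g = g],
      so
      [<g, g> = <K K' g, f> = <K' g, K^* f> = <K' g, P_(W_i) K^* f>], hence
      [|P_(K W_i) f| <= |K'| |P_(W_i) K^* f|].
    - For [h = P_(W_i) K^* f], the vector [K h] lies in [K W_i], so
      [<h, h> = <h, K^* f> = <K h, f> = <K h, P_(K W_i) f>], hence
      [|P_(W_i) K^* f| <= |K| |P_(K W_i) f|].
    - [<K^* f, K^* f> = <K K^* f, f>] gives [|K^* f| <= |K| |f|].

    Squaring, summing over [i], and using the frame bounds [A] and [B] of the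
    [W_i] at the vector [K^* f] gives the lower bound [A / |K|^2] and the upper
    bound [|K'|^2 B |K|^2]; in the proof, positive constants [M] and [N] with
    [|K x| <= M |x|] and [|K' x| <= N |x|] replace the operator norms.

    The existence of orthogonal projections ([orthogonal_projection]) is proved
    from the parallelogram law and completeness, and it yields the Riesz
    representation behind the adjoint ([Riesz_adjoint]). *)

(** * Real numbers inside the scalar field *)

Section Scalars.
Variables (R : realType) (k : scalar_kind).
Local Notation F := (scalar_field R k).

(** The embedding of the reals into the scalar field, a right inverse of the
    real part.  It carries statements about the scalar-valued norm to
    statements about the real-valued [hnorm]. *)
Definition of_real : {rmorphism R -> F} :=
  match k with
  | RealScalars => @idfun R
  | ComplexScalars => real_complex R
  end.

Lemma ler_of_real (x y : R) : (of_real x <= of_real y) = (x <= y).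
Proof. by rewrite /of_real; case: k => //=; rewrite lecR. Qed.

Lemma ltr_of_real (x y : R) : (of_real x < of_real y) = (x < y).
Proof. by rewrite /of_real; case: k => //=; rewrite ltcR. Qed.

Lemma of_realK : cancel of_real (@scalar_Re R k).
Proof. by rewrite /of_real; case: k => //=. Qed.

Lemma scalar_ReK (a : F) : 0 <= a -> of_real (scalar_Re a) = a.
Proof.
rewrite /of_real; move: a; case: k => //= a.
by rewrite lecE /= => /andP[/eqP a0 _]; case: a a0 => x y /= ->.
Qed.

Lemma scalar_conj_mul (a : F) : a * scalar_conj R k a = `|a| ^+ 2.
Proof.
move: a; case: k => /= a; last by rewrite -normCK.
by rewrite real_normK ?num_real // expr2.
Qed.

End Scalars.

(** * Inner products and norms *)

Section Hilbert.
Variables (R : realType) (k : scalar_kind) (H : hilbertType R k).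
Local Notation F := (scalar_field R k).
Local Notation conj := (scalar_conj R k).
Local Notation r := (@of_real R k).
Implicit Types (u v x y z f g : H) (V : set H) (a : F).

Lemma of_real_hnorm x : r (hnorm x) = `|x|.
Proof. by rewrite scalar_ReK. Qed.

Lemma hnorm_ge0 x : 0 <= hnorm x.
Proof. by rewrite -(@ler_of_real R k) of_real_hnorm rmorph0. Qed.

Lemma ler_hnormD x y : hnorm (x + y) <= hnorm x + hnorm y.
Proof. by rewrite -(@ler_of_real R k) rmorphD /= !of_real_hnorm ler_normD. Qed.

Lemma innerC x y : inner x y = conj (inner y x).
Proof. by rewrite (hermC inner) expr0 mul1r. Qed.

Lemma innerBl x y z : inner (x - y) z = inner x z - inner y z.
Proof. exact: linearBl. Qed.

Lemma innerDl x y z : inner (x + y) z = inner x z + inner y z.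
Proof. exact: linearDl. Qed.

Lemma innerBr x y z : inner x (y - z) = inner x y - inner x z.
Proof. by rewrite !(innerC x) innerBl rmorphB. Qed.

Lemma innerDr x y z : inner x (y + z) = inner x y + inner x z.
Proof. by rewrite !(innerC x) innerDl rmorphD. Qed.

Lemma innerZl a x y : inner (a *: x) y = a * inner x y.
Proof. exact: linearZl_LR. Qed.

Lemma innerZr a x y : inner x (a *: y) = conj a * inner x y.
Proof. by rewrite !(innerC x) innerZl rmorphM. Qed.

Lemma inner0l y : inner 0 y = 0.
Proof. exact: linear0l. Qed.

Lemma parallelogram x y :
  hnorm (x + y) ^+ 2 + hnorm (x - y) ^+ 2 = 2 * (hnorm x ^+ 2 + hnorm y ^+ 2).
Proof.
apply: (can_inj (@of_realK R k)).
rewrite !(rmorphD, rmorphM, rmorphXn, rmorph1, of_real_hnorm) /=.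
rewrite -!inner_norm !(innerBl, innerBr, innerDl, innerDr).
ring.
Qed.

(** Pythagoras for the component of [x] orthogonal to the line spanned by [y];
    both Cauchy-Schwarz and the orthogonality of nearest points follow from
    it. *)
Lemma norm_sub_proj_line x y : y != 0 ->
  `|x - (inner x y / inner y y) *: y| ^+ 2 =
  `|x| ^+ 2 - `|inner x y| ^+ 2 / `|y| ^+ 2.
Proof.
move=> y0; have n0 : inner y y != 0 by rewrite inner_norm expf_neq0 ?normr_eq0.
have cn : conj (inner x y / inner y y) = conj (inner x y) / inner y y.
  by rewrite fmorph_div; congr (_ / _); rewrite -[LHS]innerC.
rewrite -!inner_norm -scalar_conj_mul.
rewrite !(innerBl, innerBr, innerZl, innerZr).
rewrite cn -(innerC y x).
by rewrite mulfVK // !(mulrA, mulrAC _ (inner y y)^-1); ring.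
Qed.

Lemma Cauchy_Schwarz x y : `|inner x y| <= `|x| * `|y|.
Proof.
have [->|y0] := eqVneq y 0.
  by rewrite innerC inner0l rmorph0 normr0 mulr_ge0.
rewrite -(@ler_pXn2r _ 2) ?nnegrE ?mulr_ge0 // exprMn.
rewrite -ler_pdivrMr ?exprn_gt0 ?normr_gt0 // -subr_ge0.
by rewrite -norm_sub_proj_line // exprn_ge0.
Qed.

Lemma hnormB x y : hnorm (x - y) = hnorm (y - x).
Proof. by rewrite /hnorm distrC. Qed.

Lemma hnorm_lt x a : 0 < a -> (`|x| < a) = (hnorm x < scalar_Re a).
Proof.
move=> a0; rewrite -(@ltr_of_real R k) of_real_hnorm scalar_ReK //.
exact: ltW.
Qed.

Lemma scalar_Re_gt0 a : 0 < a -> 0 < scalar_Re a.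
Proof.
by move=> a0; rewrite -(@ltr_of_real R k) rmorph0 scalar_ReK // ltW.
Qed.

(** * Orthogonal projections *)

Lemma closed_subspaceP V : closed_subspace V <->
  [/\ V 0, forall a x y, V x -> V y -> V (a *: x + y) & closed V].
Proof.
split=> [[[V0 VD] clV]|[V0 VD clV]].
  split=> //; first by rewrite inE in V0.
  by move=> a x y Vx Vy; have := VD a x y; rewrite !inE; apply.
split=> //; split; first by rewrite inE.
by move=> a x y; rewrite !inE; exact: VD.
Qed.

(** The points of [V] whose distance to [f] exceeds the infimum [d] by less
    than [e] form, as [e] decreases to 0, a Cauchy filter base by the
    parallelogram law; its limit is the nearest point. *)
Lemma nearest_point V f : closed_subspace V ->
  exists2 g, V g & forall v, V v -> hnorm (f - g) <= hnorm (f - v).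
Proof.
move=> /closed_subspaceP[V0 VD clV].
pose E := [set hnorm (f - v) | v in V]; pose d := inf E.
have infE : has_inf E.
  split; first by exists (hnorm (f - 0)), 0.
  by exists 0 => _ [v _ <-]; exact: hnorm_ge0.
have d_le v : V v -> d <= hnorm (f - v).
  by move=> Vv; apply: ge_inf; [exact: infE.2|exists v].
have d0 : 0 <= d.
  by apply: lb_le_inf infE.1 _ => _ [v _ <-]; exact: hnorm_ge0.
pose B (e : R) := V `&` [set v | hnorm (f - v) < d + e].
pose G := filter_from [set e : R | 0 < e] B.
have GF : ProperFilter G.
  apply: filter_from_proper; last first.
    move=> e e0; have [_ [v Vv <-] vd] := inf_adherent e0 infE.
    by exists v.
  apply: filter_from_filter; first by exists 1; exact: ltr01.
  move=> e1 e2 /= e10 e20; exists (Num.min e1 e2).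
    by rewrite /= lt_min e10.
  move=> v [Vv] /=; rewrite /B /= -ltrBlDl lt_min !ltrBlDl => /andP[? ?].
  by split.
(* Since the midpoint [m] of [u] and [v] is at distance at least [d] from [f],
   [|u - v|^2 = 2 |f - u|^2 + 2 |f - v|^2 - 4 |f - m|^2] is at most
   [4 (d + e)^2 - 4 d^2]. *)
have diam e u v : 0 < e -> B e u -> B e v ->
    hnorm (u - v) ^+ 2 <= 8 * d * e + 4 * e ^+ 2.
  move=> e0 [Vu /= ud] [Vv /= vd].
  pose m := 2^-1 *: (u + v).
  have Vm : V m.
    rewrite /m -[2^-1 *: _]addr0; apply: (VD _ _ _ _ V0).
    by rewrite -[u]scale1r; exact: VD.
  have := parallelogram (f - v) (f - u).
  have -> : f - v - (f - u) = u - v by rewrite opprB addrC addrA subrK.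
  have -> : f - v + (f - u) = (f - m) *+ 2.
    rewrite mulrnBl -[m *+ 2]scaler_nat /m scalerA divff ?scale1r ?pnatr_eq0 //.
    by rewrite addrACA -opprD mulr2n [v + u]addrC.
  have -> : hnorm ((f - m) *+ 2) = hnorm (f - m) *+ 2.
    apply: (can_inj (@of_realK R k)).
    by rewrite rmorphMn /= !of_real_hnorm normrMn.
  have p0 := hnorm_ge0 (f - u); have q0 := hnorm_ge0 (f - v).
  have ms := d_le _ Vm; have s0 := hnorm_ge0 (f - m).
  have : hnorm (f - u) ^+ 2 <= (d + e) ^+ 2 by rewrite lerXn2r ?nnegrE //; lra.
  have : hnorm (f - v) ^+ 2 <= (d + e) ^+ 2 by rewrite lerXn2r ?nnegrE //; lra.
  have : d ^+ 2 <= hnorm (f - m) ^+ 2 by rewrite lerXn2r ?nnegrE //; lra.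
  rewrite -[hnorm (f - m) *+ 2]mulr_natl exprMn sqrrD => h1 h2 h3 h.
  lra.
have cauG : cauchy G.
  apply: cauchy_exP => a a0; have e0 := scalar_Re_gt0 a0.
  set e := scalar_Re a in e0.
  (* As [c <= 1], the bound [8 d c + 4 c^2] of [diam] is at most
     [(8 d + 4) c], which is below [e^2]. *)
  pose c := e ^+ 2 / (8 * d + 4 + e ^+ 2).
  have den0 : 0 < 8 * d + 4 + e ^+ 2 by nra.
  have c0 : 0 < c by rewrite divr_gt0 // exprn_gt0.
  have c1 : c <= 1 by rewrite ler_pdivrMr //; nra.
  have ce : (8 * d + 4) * c < e ^+ 2.
    rewrite mulrA ltr_pdivrMr // mulrC ltr_pM2l ?exprn_gt0 // ltrDl.
    exact: exprn_gt0.
  have [_ [v Vv <-] vd] := inf_adherent c0 infE.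
  exists v, c => // u Bu.
  rewrite -ball_normE /= hnorm_lt // -/e.
  rewrite -(@ltr_pXn2r _ 2) ?nnegrE ?hnorm_ge0 ?ltW //.
  apply: le_lt_trans (diam c _ _ c0 _ Bu) _; first by split.
  nra.
have /cauchy_cvgP Gcvg := cauG; have /cvg_ex[g Gg] := Gcvg.
exists g => [|v Vv].
  apply: clV => U /Gg [e e0 BU].
  have [u Bu] := filter_ex (F := G) (ex_intro2 _ _ e e0 (fun=> id)).
  by exists u; split; [exact: Bu.1|exact: BU].
apply: le_trans (d_le _ Vv); apply/ler_addgt0Pr => e e0.
have e20 : 0 < e / 2 by rewrite divr_gt0.
have : G (ball g (r (e / 2))).
  by apply: Gg; apply: nbhsx_ballx; rewrite -(rmorph0 r) ltr_of_real.
move=> [c c0 Bc].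
(* A point [u] of [V] within [e / 2] of [g], whose distance to [f] is below
   [d + e / 2]. *)
have mc0 : 0 < Num.min (e / 2) c by rewrite lt_min e20.
have [_ [u Vu <-]] := inf_adherent mc0 infE.
rewrite -/d -ltrBlDl lt_min !ltrBlDl => /andP[ue uc].
have cu : B c u by split.
have := Bc _ cu.
rewrite -ball_normE /= hnorm_lt -?(rmorph0 r) ?ltr_of_real // of_realK.
move=> gu.
have -> : f - g = (f - u) + (u - g) by rewrite addrA subrK.
apply: le_trans (ler_hnormD _ _) _; rewrite (hnormB u).
lra.
Qed.

Lemma orthogonal_projection V f : closed_subspace V ->
  exists g, V g /\ ortho_compl V (f - g).
Proof.
move=> clV; have [g Vg gmin] := nearest_point f clV.
have [_ VD _] := (closed_subspaceP V).1 clV.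
(* The nearest point is compared with its translate by the component of [f - g]
   along [y], which must vanish. *)
exists g; split=> // y Vy; have [->|y0] := eqVneq y 0.
  by rewrite innerC inner0l rmorph0.
have := gmin _ (VD (inner (f - g) y / inner y y) _ _ Vy Vg).
rewrite -(@ler_of_real R k) !of_real_hnorm opprD addrCA addrC.
rewrite -(@ler_pXn2r _ 2) ?nnegrE // norm_sub_proj_line //.
rewrite -subr_ge0 addrAC subrr add0r oppr_ge0.
rewrite pmulr_lle0 ?invr_gt0 ?exprn_gt0 ?normr_gt0 // => le0.
by apply/normr0_eq0/eqP; rewrite -sqrf_eq0 eq_le le0 exprn_ge0.
Qed.

Lemma orth_projP V f : closed_subspace V ->
  V (orth_proj V f) /\ ortho_compl V (f - orth_proj V f).
Proof.
move=> /(orthogonal_projection f) [g Pg]; rewrite /orth_proj.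
by case: xgetP => [|/(_ g)].
Qed.

(** Against a vector of [V], the projection onto [V] may be inserted or dropped
    in the second argument of the inner product. *)
Lemma inner_orth_proj V f y : closed_subspace V -> V y ->
  inner y (orth_proj V f) = inner y f.
Proof.
move=> clV Vy; have [_ /(_ y Vy)] := orth_projP f clV.
by rewrite innerBl => /subr0_eq; rewrite (innerC y f) (innerC y) => ->.
Qed.

(** * Bounded operators and adjoints *)

Lemma additive_bounded_continuous (U : normedModType F) (h : H -> U) a :
  0 <= a -> (forall x y, h (x - y) = h x - h y) ->
  (forall x, `|h x| <= a * `|x|) ->
  continuous h.
Proof.
move=> a0 hB hle x; apply/cvgrPdist_lt => e e0.
have a1 : 0 < a + 1 by rewrite ltr_wpDl.
near=> y; rewrite -hB; apply: le_lt_trans (hle _) _.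
apply: le_lt_trans (_ : (a + 1) * `|x - y| < _).
  by rewrite ler_wpM2r // lerDl.
rewrite mulrC -ltr_pdivlMr //; near: y.
apply: cvgr_dist_lt => //; last exact: divr_gt0.
Unshelve. all: by end_near.
Qed.

(** Typically [y] is the image of [x] under an operator of norm at most [M]. *)
Lemma hnorm_le_of_inner x y z (M : R) : 0 <= M ->
  inner x x = inner y z -> hnorm y <= M * hnorm x -> hnorm x <= M * hnorm z.
Proof.
move=> M0 xyz yM; have [x0|xn0] := eqVneq (hnorm x) 0.
  by rewrite x0 mulr_ge0 ?hnorm_ge0.
have xpos : 0 < hnorm x by rewrite lt_def xn0 hnorm_ge0.
rewrite -(ler_pM2l xpos) mulrCA mulrA -expr2.
apply: (le_trans _ (ler_wpM2r (hnorm_ge0 z) yM)).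
rewrite -(@ler_of_real R k) rmorphXn rmorphM /= !of_real_hnorm -inner_norm xyz.
apply: le_trans (Cauchy_Schwarz y z); apply: real_ler_norm.
by rewrite -xyz inner_norm realX ?normr_real.
Qed.

Implicit Type T : {linear H -> H}.

Lemma bounded_operator_gt0 T : bounded_operator T ->
  exists2 M : R, 0 < M & forall x, hnorm (T x) <= M * hnorm x.
Proof.
move=> [M TM]; exists (`|M| + 1); first by rewrite ltr_wpDl.
move=> x; apply: le_trans (TM x) _; rewrite ler_wpM2r ?hnorm_ge0 //.
by apply: le_trans (ler_norm M) _; rewrite lerDl.
Qed.

Lemma bounded_operator_continuous T : bounded_operator T -> continuous T.
Proof.
move=> /bounded_operator_gt0[M M0 TM].
apply: (@additive_bounded_continuous _ T (r M)).
- by rewrite -(rmorph0 r) ler_of_real ltW.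
- exact: linearB.
- by move=> x; rewrite -!of_real_hnorm -rmorphM ler_of_real.
Qed.

Lemma inner_continuous y : continuous (fun x => inner x y : F).
Proof.
apply: (@additive_bounded_continuous F _ `|y|) => // [x z|x].
- exact: innerBl.
- by rewrite mulrC Cauchy_Schwarz.
Qed.

Lemma closed_subspace_ker_inner T y : bounded_operator T ->
  closed_subspace [set x | inner (T x) y = 0].
Proof.
move=> Tb; apply/closed_subspaceP; split=> /= [|a u v u0 v0|].
- by rewrite linear0 inner0l.
- by rewrite linearP innerDl innerZl u0 v0 mulr0 addr0.
apply: (@preimage_closed _ F^o (fun x => inner (T x) y) [set 0]).
  move=> x _; apply: (@continuous_comp _ _ F^o T (fun x => inner x y)).
    exact: bounded_operator_continuous.
  exact: inner_continuous.
exact/accessible_closed_set1/hausdorff_accessible/norm_hausdorff.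
Qed.

(** The representing vector is a multiple of the component [e] of some [u],
    outside the kernel of [x |-> <T x, y>], that is orthogonal to this
    kernel. *)
Lemma Riesz_adjoint T y : bounded_operator T ->
  exists z, forall x, inner (T x) y = inner x z.
Proof.
move=> Tb; have [phi0|] := pselect (forall x, inner (T x) y = 0).
  by exists 0 => x; rewrite phi0 innerC inner0l rmorph0.
move=> /existsNP[u /eqP phiu].
have [g [/= Ng eN]] := orthogonal_projection u (closed_subspace_ker_inner y Tb).
set e := u - g in eN.
have phie : inner (T e) y != 0 by rewrite linearB innerBl Ng subr0.
have en0 : inner e e != 0.
  rewrite inner_norm expf_neq0 // normr_eq0.
  by apply: contraNneq phie => ->; rewrite linear0 inner0l.
exists (conj (inner (T e) y / inner e e) *: e) => x.
rewrite innerZr rmorphK.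
(* Every [x] differs from a multiple of [e] by an element of the kernel. *)
have /eN/(congr1 conj) :
    inner (T (x - (inner (T x) y / inner (T e) y) *: e)) y = 0.
  by rewrite linearB linearZ innerBl innerZl divfK // subrr.
rewrite -innerC rmorph0 innerBl innerZl => /subr0_eq ->.
by rewrite mulrCA !divfK.
Qed.

Lemma adjointP T x y : bounded_operator T ->
  inner (T x) y = inner x (adjoint T y).
Proof.
move=> /(Riesz_adjoint y)[z Pz]; rewrite /adjoint.
by case: xgetP => [w _ ->|/(_ z)].
Qed.

(** * Images under an operator with a pseudo-inverse *)

(** If [S] is a pseudo-inverse of [T] and [S T] maps [V] into itself, the image
    of [V] is cut out of the range of [T] by a condition that is closed
    whenever [V] is. *)
Lemma image_pinvE T S V : is_pseudo_inverse T S ->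
  (forall x, V x -> V (S (T x))) ->
  T @` V = range T `&` S @^-1` V.
Proof.
move=> [_ _ _ TS] VST; apply/seteqP; split=> y /=.
  by move=> [x Vx <-]; split; [exists x|exact: VST].
by move=> [Ty VSy]; exists (S y); [|exact: TS].
Qed.

Lemma closed_subspace_image T S V : is_pseudo_inverse T S ->
  closed (range T) -> (forall x, V x -> V (S (T x))) ->
  closed_subspace V -> closed_subspace (T @` V).
Proof.
move=> TS clT VST /closed_subspaceP[V0 VD clV]; apply/closed_subspaceP; split.
- by exists 0; rewrite ?linear0.
- move=> a _ _ [u Vu <-] [v Vv <-]; exists (a *: u + v); first exact: VD.
  by rewrite linearP.
rewrite (image_pinvE TS VST); apply: closedI => //.
apply: preimage_closed => // x _; apply: bounded_operator_continuous.
by case: TS.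
Qed.

End Hilbert.

(** * Fusion frames *)

Lemma esum_le_scale (R : realType) (I : choiceType) (a b : I -> R) (c : R) :
  0 <= c -> (forall i, 0 <= b i) -> (forall i, a i <= c * b i) ->
  (\esum_(i in [set: I]) (a i)%:E <= c%:E * \esum_(i in [set: I]) (b i)%:E)%E.
Proof.
move=> c0 b0 ab; apply: ge_ereal_sup => _ [X [finX XI] <-].
apply: (@le_trans _ _ (\sum_(i \in X) (c%:E * (b i)%:E))%E).
  by apply: lee_fsum => // i _; rewrite -EFinM lee_fin.
rewrite -ge0_mule_fsumr; last by move=> i; rewrite lee_fin.
apply: lee_wpmul2l; first by rewrite lee_fin.
by apply: ereal_sup_ubound; exists X.
Qed.

Theorem theorem16 (R : realType) (k : scalar_kind) (H : hilbertType R k)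
    (H_separable : separable H)
    (K Kdag : {linear H -> H})
    (K_bounded : bounded_operator K)
    (K_closed_range : closed (range K))
    (Kdag_pinv : is_pseudo_inverse K Kdag)
    (I : countType) (W : I -> set H) (w : I -> R)
    (W_invariant : forall i, [set Kdag (K x) | x in W i] `<=` W i) :
  fusion_frame W w -> K_fusion_frame (fun i => K @` W i) w K.
Proof.
move=> [Ww [A [B [A0 AB frameW]]]].
have WK i x : W i x -> W i (Kdag (K x)).
  by move=> Wx; apply: W_invariant; exists x.
have clKW i : closed_subspace (K @` W i).
  apply: closed_subspace_image Kdag_pinv _ _ _ => //; first exact: WK.
  exact: (Ww i).1.
have [M M0 KM] := bounded_operator_gt0 K_bounded.
have [Kdag_bounded _ _ KKdag] := Kdag_pinv.
have [N N0 KdagN] := bounded_operator_gt0 Kdag_bounded.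
have adjM f : hnorm (adjoint K f) <= M * hnorm f.
  by apply: (hnorm_le_of_inner (ltW M0) _ (KM _)); rewrite adjointP.
have projKW_le i f :
    hnorm (orth_proj (K @` W i) f) <= N * hnorm (orth_proj (W i) (adjoint K f)).
  have [KWg _] := orth_projP f (clKW i).
  apply: (hnorm_le_of_inner (ltW N0) _ (KdagN _)); move: (KWg) => [x Wx Kx].
  have Wg : W i (Kdag (orth_proj (K @` W i) f)) by rewrite -Kx; exact: WK.
  rewrite (inner_orth_proj _ (clKW i) KWg) (inner_orth_proj _ (Ww i).1 Wg).
  by rewrite -adjointP // KKdag //; exists x.
have projW_le i f :
    hnorm (orth_proj (W i) (adjoint K f)) <= M * hnorm (orth_proj (K @` W i) f).
  have [Wh _] := orth_projP (adjoint K f) (Ww i).1.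
  apply: (hnorm_le_of_inner (ltW M0) _ (KM _)).
  rewrite (inner_orth_proj _ (Ww i).1 Wh) -adjointP //.
  by rewrite (inner_orth_proj _ (clKW i) (imageP _ Wh)).
have frame_le (U V : I -> set H) (c : R) g f : 0 < c ->
    (forall i, hnorm (orth_proj (U i) g) <= c * hnorm (orth_proj (V i) f)) ->
    (frame_sum U w g <= (c ^+ 2)%:E * frame_sum V w f)%E.
  move=> c0 UV; apply: esum_le_scale => [|i|i]; rewrite ?sqr_ge0 //.
    by rewrite mulr_ge0 ?sqr_ge0.
  rewrite [leRHS]mulrCA ler_wpM2l ?sqr_ge0 // -exprMn.
  by rewrite lerXn2r ?nnegrE ?mulr_ge0 ?hnorm_ge0 // ltW.
split=> [i|]; first by split; [exact: clKW|exact: (Ww i).2].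
have M2 : 0 < M ^+ 2 by rewrite exprn_gt0.
(* The constant [A / M ^+ 2] multiplies [|K^* f|^2] and not [|f|^2], so it can
   exceed [N ^+ 2 * (B * M ^+ 2)], for instance when [K] has small norm. *)
exists (A / M ^+ 2), (Num.max (A / M ^+ 2) (N ^+ 2 * (B * M ^+ 2))).
split=> [||f]; [exact: divr_gt0|by rewrite le_max lexx|split].
  have [+ _] := frameW (adjoint K f).
  move=> /le_trans /(_ (frame_le _ _ _ _ _ M0 (projW_le^~ f))).
  by rewrite -lee_pdivrMl // -EFinM mulrA [_^-1 * A]mulrC.
apply: le_trans (frame_le _ _ _ _ _ N0 (projKW_le^~ f)) _.
have [_ /(lee_wpmul2l _)] := frameW (adjoint K f).
move=> /(_ (N ^+ 2)%:E); rewrite lee_fin sqr_ge0 => /(_ isT) /le_trans; apply.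
rewrite -EFinM lee_fin.
apply: (@le_trans _ _ (N ^+ 2 * (B * M ^+ 2) * hnorm f ^+ 2)).
  rewrite -(mulrA (N ^+ 2)) ler_wpM2l ?sqr_ge0 //.
  rewrite -(mulrA B) ler_wpM2l ?(le_trans (ltW A0)) //.
  by rewrite -exprMn lerXn2r ?nnegrE ?mulr_ge0 ?hnorm_ge0 // ltW.
by rewrite ler_wpM2r ?sqr_ge0 // le_max lexx orbT.
Qed.
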